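(* Let $G$ be a finite $2$-group. For every finite field $F$ of characteristic two, there is an integer $\Theta$ such that $$|V_*(FG)|=\Theta\cdot |F|^{\frac{1}{2}(|G|+|G\{2\}|)-1}.$$ Moreover, if there is an element $c$ of order two in the center of $G$ such that the set $T_c=\{g\in G\mid g^2=c\}$ is commutative (that is, any two elements of $T_c$ commute with each other), then $\Theta$ does not depend on the field $F$: there is a single integer $\Theta$, depending only on $G$, such that the displayed equality holds for every finite field $F$ of characteristic two.
   Context: For a finite group $G$ and a field $F$, $FG$ is the group algebra, and $\chi\left(\sum_{g\in G}\alpha_g g\right)=\sum_{g\in G}\alpha_g$ is the augmentation map. For $G$ a finite $2$-group and $F$ of characteristic $2$, $V(FG)=\{x\in FG \mid \chi(x)=1\}$ is the group of normalized units of $FG$. The canonical involution $*$ of $FG$ is the $F$-linear extension of $g\mapsto g^{-1}$, i.e. $\left(\sum_{g\in G}\alpha_g g\right)^*=\sum_{g\in G}\alpha_g g^{-1}$. The $*$-unitary subgroup is $V_*(FG)=\{u\in V(FG)\mid u^*=u^{-1}\}$. $G\{2\}=\{g\in G\mid g^2=1\}$, which includes the identity element. *)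

(* Defs.v *)
From HB Require Import structures.
From mathcomp Require Import all_boot all_order all_algebra all_fingroup all_solvable.

Set Implicit Arguments.
Unset Strict Implicit.
Unset Printing Implicit Defensive.

Import GRing.Theory.
Local Open Scope ring_scope.

(* [galg F gT] is the group algebra F[gT]: x stands for the formal sum of the
   x g . g.  It is a new name for {ffun gT -> F}, so that the convolution
   product below does not clash with the pointwise product of {ffun _ -> _}. *)
Definition galg (F : finFieldType) (gT : finGroupType) := {ffun gT -> F}.

Section GroupAlgebra.

Variables (F : finFieldType) (gT : finGroupType).
Local Notation A := (galg F gT).
Implicit Types (x y z : A) (a : F) (g h : gT).

HB.instance Definition _ := Finite.on A.
HB.instance Definition _ := GRing.Zmodule.on A.

Definition galg_one : A := [ffun g => (g == 1%g)%:R].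

Definition galg_mul x y : A := [ffun g => \sum_h x h * y (h^-1 * g)%g].

Fact galg_mulA : associative galg_mul.
Proof.
move=> x y z; apply/ffunP => g; rewrite !ffunE.
under eq_bigr => h _ do rewrite ffunE big_distrr /=.
under [RHS]eq_bigr => h _ do rewrite ffunE big_distrl /=.
rewrite [RHS]exchange_big /=; apply: eq_bigr => h _.
rewrite [RHS](reindex_inj (mulgI h)) /=; apply: eq_bigr => k _.
by rewrite mulrA mulKg invMg mulgA.
Qed.

Fact galg_mul1x : left_id galg_one galg_mul.
Proof.
move=> x; apply/ffunP => g; rewrite ffunE (bigD1 1%g) //= ffunE eqxx mul1r.
rewrite invg1 mul1g big1 ?addr0 // => h /negPf h1.
by rewrite ffunE h1 mul0r.
Qed.

Fact galg_mulx1 : right_id galg_one galg_mul.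
Proof.
move=> x; apply/ffunP => g; rewrite ffunE (bigD1 g) //= ffunE mulVg eqxx mulr1.
rewrite big1 ?addr0 // => h hg.
by rewrite ffunE -eq_mulVg1 (negPf hg) mulr0.
Qed.

Fact galg_mulDl : left_distributive galg_mul +%R.
Proof.
move=> x y z; apply/ffunP => g; rewrite !ffunE -big_split /=.
by apply: eq_bigr => h _; rewrite ffunE mulrDl.
Qed.

Fact galg_mulDr : right_distributive galg_mul +%R.
Proof.
move=> x y z; apply/ffunP => g; rewrite !ffunE -big_split /=.
by apply: eq_bigr => h _; rewrite ffunE mulrDr.
Qed.

Fact galg_one_neq0 : galg_one != 0.
Proof. by apply/eqP => /ffunP/(_ 1%g)/eqP; rewrite !ffunE eqxx oner_eq0. Qed.

HB.instance Definition _ := GRing.Zmodule_isNzRing.Build A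
  galg_mulA galg_mul1x galg_mulx1 galg_mulDl galg_mulDr galg_one_neq0.

Definition galg_scale a x : A := [ffun g => a * x g].

Fact galg_scaleA a b x : galg_scale a (galg_scale b x) = galg_scale (a * b) x.
Proof. by apply/ffunP => g; rewrite !ffunE mulrA. Qed.

Fact galg_scale1 : left_id 1 galg_scale.
Proof. by move=> x; apply/ffunP => g; rewrite ffunE mul1r. Qed.

Fact galg_scaleDr : right_distributive galg_scale +%R.
Proof. by move=> a x y; apply/ffunP => g; rewrite !ffunE mulrDr. Qed.

Fact galg_scaleDl x : {morph galg_scale^~ x : a b / a + b}.
Proof. by move=> a b; apply/ffunP => g; rewrite !ffunE mulrDl. Qed.

HB.instance Definition _ := GRing.Zmodule_isLmodule.Build F A
  galg_scaleA galg_scale1 galg_scaleDr galg_scaleDl.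

Fact galg_scaleAl a x y : a *: (x * y) = (a *: x) * y.
Proof.
apply/ffunP => g; rewrite !ffunE big_distrr /=.
by apply: eq_bigr => h _; rewrite ffunE mulrA.
Qed.

HB.instance Definition _ := GRing.Lmodule_isLalgebra.Build F A galg_scaleAl.

Fact galg_scaleAr a x y : a *: (x * y) = x * (a *: y).
Proof.
apply/ffunP => g; rewrite !ffunE big_distrr /=.
by apply: eq_bigr => h _; rewrite ffunE mulrCA.
Qed.

HB.instance Definition _ := GRing.Lalgebra_isAlgebra.Build F A galg_scaleAr.
HB.instance Definition _ := FinRing.isNzRing.Build A.

Definition galg_of g : A := [ffun h => (h == g)%:R].

Definition augmentation x : F := \sum_g x g.

Definition canonical_involution x : A := \sum_g x g *: galg_of g^-1.

End GroupAlgebra.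

(* When F has characteristic p and gT is a p-group (the only case in which this
   is used), every element of augmentation 1 is invertible. *)
Definition normalized_units (F : finFieldType) (gT : finGroupType)
    : {set galg F gT} :=
  [set x | augmentation x == 1].

Definition unitary_units (F : finFieldType) (gT : finGroupType)
    : {set galg F gT} :=
  [set u in normalized_units F gT | canonical_involution u == u^-1].

Definition square_roots (gT : finGroupType) (c : gT) : {set gT} :=
  [set g | (g ^+ 2)%g == c].

(* (|G| + |G{2}|) / 2 - 1, with G{2} = square_roots 1.  Nothing is lost in nat:
   g |-> g^-1 is an involution of G with fixed point set G{2}, so |G| and
   |G{2}| have the same parity, and both are at least 1. *)
Definition unitary_exponent (gT : finGroupType) : nat :=
  ((#|gT| + #|square_roots (1%g : gT)|)./2 - 1)%N.

(* Main.v *)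
Require Import Defs.
From mathcomp Require Import all_boot all_order all_algebra all_fingroup all_solvable.
From mathcomp Require Import ring.

(* Write x' for the canonical involution of x, and let psi be the additive
   character of F of order two that is trivial exactly on the elements b^2 + b.
   Since u is unitary iff u u' = 1, Fourier inversion on F^G gives
     |F|^|G| |V_*| = sum_mu sum_(x in V) psi (Q_mu x + mu_1),
     Q_mu x = sum_k mu_k (x x')_k.
   Each Q_mu is a quadratic form with polar form (x, y) |-> sum_g x_g (lam y)_g,
   where lam = mu + mu'. The inner sum vanishes as soon as some z of augmentation
   0 has lam z constant, equal to a say, and Q_mu z <> a^2. If there is no such z,
   then lam is a homomorphism from G to the prime field F_2, and the inner sum
   equals |V|. There are |F|^((|G| + |G{2}|)/2) functions mu for each homomorphism
   lam that is trivial on G{2}, and none for the others, so Theta is the number of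
   homomorphisms G -> F_2 that are trivial on G{2}, for every 2-group G and every
   F. *)

Set Implicit Arguments.
Unset Strict Implicit.
Unset Printing Implicit Defensive.

Import GRing.Theory.
Local Open Scope ring_scope.

(** * Orbits of involutions, and symmetric sums in characteristic two *)

(** [R] keeps the lower-ranked element of each orbit; [R] and [f @: R] cover [S] and meet in the
    fixed points. *)
Lemma card_involution (T : finType) (S : {set T}) (f : T -> T) :
    involutive f -> (forall x, x \in S -> f x \in S) ->
  (#|S| + #|[set x in S | f x == x]|)%N
    = #|[set x in S | (enum_rank x <= enum_rank (f x))%N]|.*2.
Proof.
move=> fK fS; set R := [set x in S | (_ <= _)%N].
have fRcard : #|f @: R| = #|R| by rewrite card_imset //; exact: inv_inj.
have mem_fR x : (x \in f @: R) = (x \in S) && (enum_rank (f x) <= enum_rank x)%N.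
  apply/imsetP/andP => [[y /[!inE]/andP[yS ley] ->]|[xS lex]].
    by rewrite fK fS.
  by exists (f x); rewrite ?inE ?fK // fS.
rewrite -addnn -{2}fRcard -[RHS]cardsUI; congr (_ + _)%N; apply: eq_card => x.
  by rewrite in_setU mem_fR inE -andb_orr leq_total andbT.
rewrite in_setI mem_fR !inE; case: (x \in S) => //=.
rewrite -eqn_leq (inj_eq val_inj) (inj_eq enum_rank_inj) eq_sym //.
Qed.

(** The terms at [(i, j)] and [(j, i)] cancel, which leaves the diagonal. *)
Lemma sum_sym_pchar2 (R : nzRingType) (I : finType) (S : I -> I -> R) :
    2%N \in [pchar R] -> (forall i j, S i j = S j i) ->
  \sum_i \sum_j S i j = \sum_i S i i.
Proof.
move=> R2 symS; pose r (i : I) : nat := enum_rank i.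
have ltS : \sum_i \sum_(j | (r i < r j)%N) S i j
         = \sum_i \sum_(j | (r j < r i)%N) S i j.
  rewrite (exchange_big_dep xpredT) //=.
  by apply: eq_bigr => i _; apply: eq_bigr.
have splitS i : \sum_j S i j =
    S i i + (\sum_(j | (r i < r j)%N) S i j + \sum_(j | (r j < r i)%N) S i j).
  rewrite (bigD1 i) //=; congr (_ + _).
  rewrite (bigID (fun j => (r i < r j)%N)) /=; congr (_ + _); apply: eq_bigl => j.
    by case: eqP => [->|]; rewrite ?ltnn.
  by rewrite -leqNgt ltn_neqAle (inj_eq val_inj) (inj_eq enum_rank_inj).
by under eq_bigr do rewrite splitS; rewrite !big_split /= ltS addrr_pchar2 // addr0.
Qed.

Lemma sum_sqr_pchar2 (R : comNzRingType) (I : finType) (f : I -> R) :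
  2%N \in [pchar R] -> (\sum_i f i) ^+ 2 = \sum_i f i ^+ 2.
Proof.
move=> R2; rewrite expr2 mulr_suml; under eq_bigr do rewrite mulr_sumr.
by rewrite sum_sym_pchar2 // => i j; rewrite mulrC.
Qed.

(** * The sign character of [F] and vanishing sums *)

Section ArtinSchreier.

Variables (F : finFieldType) (F2 : 2%N \in [pchar F]).
Implicit Types a b : F.

Definition artin_schreier a := a ^+ 2 + a.
Definition as_image : {set F} := artin_schreier @: setT.
(** This is psi, valued in the integers so that its sums can be compared with cardinalities. *)
Definition as_sign a : int := if a \in as_image then 1 else -1.

Lemma artin_schreierD a b :
  artin_schreier (a + b) = artin_schreier a + artin_schreier b.
Proof. by rewrite /artin_schreier sqrrD mulr2n addrr_pchar2 // addr0 addrACA. Qed.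

Lemma artin_schreier_eq a b :
  artin_schreier a = artin_schreier b -> a = b \/ a = b + 1.
Proof.
move=> eq_ab; have: artin_schreier (a + b) = 0.
  by rewrite artin_schreierD eq_ab addrr_pchar2.
rewrite /artin_schreier expr2 -{3}[a + b]mul1r -mulrDl => /eqP; rewrite mulf_eq0.
rewrite -addrA addr_eq0 oppr_pchar2 // addr_eq0 oppr_pchar2 // orbC.
by case/orP=> /eqP; [left | right].
Qed.

(** The fibres of [artin_schreier] are the orbits of the fixed-point-free involution
    [a |-> a + 1]. *)
Lemma card_asset : #|as_image|.*2 = #|F|.
Proof.
have sK : involutive (fun a : F => a + 1).
  by move=> a; rewrite -addrA addrr_pchar2 // addr0.
have := @card_involution F setT _ sK (fun x _ => in_setT _).
set R := [set x in _ | (_ <= _)%N]; rewrite cardsT => cardR.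
have <- : #|artin_schreier @: R| = #|as_image|.
  apply: eq_card => x; apply/imsetP/imsetP=> [[a _ ->]|[a _ ->]]; first by exists a.
  case: (leqP (enum_rank a) (enum_rank (a + 1))) => [le_a|lt_a].
    by exists a; rewrite // !inE.
  exists (a + 1); first by rewrite !inE /= sK ltnW.
  by rewrite artin_schreierD /(artin_schreier 1) expr1n addrr_pchar2 // addr0.
rewrite card_in_imset => [|a b /[!inE]/= ra rb /artin_schreier_eq[//|ab]].
  rewrite -cardR -[RHS]addn0; congr (_ + _)%N; apply/eqP; rewrite cards_eq0.
  apply/eqP/setP=> a; rewrite !inE /= -[X in _ == X]addr0.
  by rewrite (inj_eq (addrI a)) oner_eq0.
apply/enum_rank_inj/val_inj/eqP; rewrite eqn_leq.
by move: ra; rewrite ab sK => ->; rewrite rb.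
Qed.

Lemma as_imageD a b : a \in as_image -> b \in as_image -> a + b \in as_image.
Proof.
move=> /imsetP[c _ ->] /imsetP[d _ ->].
by rewrite -artin_schreierD; exact: imset_f.
Qed.

Lemma as_image_addl a b : a \in as_image -> (a + b \in as_image) = (b \in as_image).
Proof.
move=> aS; apply/idP/idP=> [abS|]; last exact: as_imageD.
by rewrite -(addKr_pchar2 F2 a b) as_imageD.
Qed.

(** The translate of the image by [a] is disjoint from it and fills the other half of [F]. *)
Lemma as_imageC_addl a b :
  a \notin as_image -> (a + b \in as_image) = (b \notin as_image).
Proof.
move=> aS; set aS' := [set a + x | x in as_image].
have as_image_aS' : [disjoint as_image & aS'].
  apply/pred0P=> x /=; apply/negP=> /andP[xS /imsetP[y yS eqx]].
  by case/negP: aS; rewrite -(as_image_addl _ yS) addrC -eqx.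
have aS'E : aS' = ~: as_image.
  apply/eqP; rewrite eqEcard subsetC -disjoints_subset as_image_aS' /=.
  rewrite -(leq_add2l #|as_image|) cardsC -card_asset -addnn leq_add2l.
  by rewrite [#|aS'|]card_imset ?leqnn //; apply: addrI.
rewrite -in_setC -aS'E; apply/idP/imsetP=> [abS|[x xS ->]].
  by exists (a + b); rewrite ?(addKr_pchar2 F2).
by rewrite (addKr_pchar2 F2).
Qed.

Lemma as_signD a b : as_sign (a + b) = as_sign a * as_sign b.
Proof.
rewrite /as_sign; case: (boolP (a \in as_image)) => aS.
  by rewrite as_image_addl // mul1r.
by rewrite as_imageC_addl //; case: (b \in as_image); rewrite ?mulr1 ?mulrNN.
Qed.

Lemma as_signX2 a : as_sign (a ^+ 2) = as_sign a.
Proof.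
rewrite /as_sign -(@as_image_addl (artin_schreier a)) ?imset_f //.
by rewrite /artin_schreier addrAC addrr_pchar2 // add0r.
Qed.

Lemma as_sign_artin_schreier a : as_sign (artin_schreier a) = 1.
Proof. by rewrite /as_sign imset_f. Qed.

Lemma as_sign0 : as_sign 0 = 1.
Proof. by rewrite -(addrr_pchar2 F2 1) -{1}(expr1n _ 2) as_sign_artin_schreier. Qed.

Lemma as_sign_nontrivial a : a != 0 -> exists b, as_sign (b * a) = -1.
Proof.
move=> a0; have [b bS] : exists b, b \notin as_image.
  have: as_image \proper setT.
    rewrite properEcard subsetT cardsT -card_asset -addnn -{1}[#|as_image|]addn0.
    rewrite ltn_add2l card_gt0; apply/set0Pn; exists (artin_schreier 0).
    exact: imset_f.
  by case/properP=> _ [b _ bS]; exists b.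
by exists (b / a); rewrite divfK // /as_sign (negPf bS).
Qed.

End ArtinSchreier.

Lemma sum_eq0_odd (I : finType) (P : pred I) (h : I -> I) (f : I -> int) :
    injective h -> (forall i, P (h i) = P i) ->
    (forall i, P i -> f (h i) = - f i) ->
  \sum_(i | P i) f i = 0.
Proof.
move=> h_inj hP hf; apply/eqP; rewrite -Num.Theory.eqNr; apply/eqP.
rewrite -sumrN [RHS](reindex_inj h_inj) (eq_bigl _ _ hP).
by apply: eq_bigr => i /hf ->.
Qed.

(** * The group algebra of a 2-group in characteristic two *)

Section GroupAlgebra.

Variables (F : finFieldType) (gT : finGroupType).
Local Notation A := (galg F gT).
Implicit Types (x y z mu : A) (a : F) (g h k : gT).

Lemma galg_addE x y g : (x + y) g = x g + y g.
Proof. by rewrite ffunE. Qed.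

Lemma galg_scaleE a x g : (a *: x) g = a * x g.
Proof. by rewrite ffunE. Qed.

Lemma galg_mulE x y g : (x * y) g = \sum_h x (g * h^-1)%g * y h.
Proof.
rewrite [LHS]ffunE (reindex_inj (@invg_inj gT)) (reindex_inj (mulIg g^-1)%g) /=.
by apply: eq_bigr => h _; rewrite !invMg !invgK mulgKV.
Qed.

Lemma galg_mul_of x g h : (x * galg_of F g) h = x (h * g^-1)%g.
Proof.
rewrite galg_mulE (bigD1 g) //= ffunE eqxx mulr1 big1 ?addr0 // => k /negPf kg.
by rewrite ffunE kg mulr0.
Qed.

Lemma canonical_involutionE x g : canonical_involution x g = x g^-1%g.
Proof.
rewrite /canonical_involution sum_ffunE (bigD1 g^-1%g) //= !ffunE invgK eqxx.
rewrite mulr1 big1 ?addr0 // => h /negPf hg.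
by rewrite !ffunE -(inj_eq invg_inj) invgK eq_sym hg mulr0.
Qed.

Lemma augmentationD x y : augmentation (x + y) = augmentation x + augmentation y.
Proof. by rewrite -big_split; apply: eq_bigr => g _; rewrite galg_addE. Qed.

Lemma augmentationZ a x : augmentation (a *: x) = a * augmentation x.
Proof. by rewrite /augmentation mulr_sumr; apply: eq_bigr => g _; rewrite ffunE. Qed.

Lemma augmentation_mul_of x k : augmentation (x * galg_of F k) = augmentation x.
Proof.
rewrite /augmentation [RHS](reindex_inj (mulIg k^-1)%g).
by apply: eq_bigr => g _; rewrite galg_mul_of.
Qed.

Lemma galg_of_mul g x h : (galg_of F g * x) h = x (g^-1 * h)%g.
Proof.
rewrite [LHS]ffunE (bigD1 g) //= ffunE eqxx mul1r big1 ?addr0 // => k /negPf kg.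
by rewrite ffunE kg mul0r.
Qed.

Lemma augmentation_of_mul k x : augmentation (galg_of F k * x) = augmentation x.
Proof.
rewrite /augmentation [RHS](reindex_inj (mulgI k^-1)%g).
by apply: eq_bigr => g _; rewrite galg_of_mul.
Qed.

Lemma augmentation1 : augmentation (1 : A) = 1.
Proof.
rewrite /augmentation (bigD1 1%g) //= ffunE eqxx big1 ?addr0 // => g /negPf g1.
by rewrite ffunE g1.
Qed.

Lemma galg_mul_ofM x g h : x * galg_of F g * galg_of F h = x * galg_of F (g * h)%g.
Proof. by apply/ffunP=> k; rewrite !galg_mul_of invMg mulgA. Qed.

Lemma galg_of1 : galg_of F 1%g = 1 :> A.
Proof. by []. Qed.

Hypotheses (F2 : 2%N \in [pchar F]) (gT2 : (2.-group [set: gT])%g).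

Lemma galg_addrr x : x + x = 0.
Proof. by apply/ffunP=> g; rewrite !ffunE addrr_pchar2. Qed.

Lemma galg_oppr x : - x = x.
Proof. by apply/ffunP=> g; rewrite ffunE oppr_pchar2. Qed.

Definition galg_act x g := x * galg_of F g.

Fact galg_act1 : galg_act^~ 1%g =1 id.
Proof. by move=> x; rewrite /galg_act galg_of1 mulr1. Qed.

Fact galg_actM x : act_morph galg_act x.
Proof. by move=> g h; rewrite /galg_act galg_mul_ofM. Qed.

Canonical galg_action := TotalAction galg_act1 galg_actM.

(* A nonzero right ideal has even order and is acted upon by the 2-group G, so it
   contains a nonzero fixed vector, i.e. a nonzero multiple of the sum of G. *)
Lemma mul_eq_const x : x != 0 -> exists y, forall g, (x * y) g = 1.
Proof.
move=> x0; set S := [set x * y | y : A].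
have actsS : [acts [set: gT], on S | galg_action]%g.
  apply/actsP=> g _ z; apply/imsetP/imsetP=> -[y _].
    move=> /= zgE; exists (y * galg_of F g^-1%g) => //.
    by rewrite mulrA -zgE /galg_act galg_mul_ofM mulgV galg_of1 mulr1.
  by move=> ->; exists (y * galg_of F g); rewrite //= /galg_act mulrA.
(* Adding the nonzero [x] pairs off the elements of the ideal, so its order is even. *)
have tK : involutive (fun z : A => z + x) by move=> z; rewrite -addrA galg_addrr addr0.
have tS z : z \in S -> z + x \in S.
  by case/imsetP=> y _ ->; rewrite -{2}[x]mulr1 -mulrDr imset_f.
have := card_involution tK tS; rewrite [X in (_ + X)%N](_ : _ = 0)%N; last first.
  apply/eqP; rewrite cards_eq0; apply/eqP/setP=> z; rewrite !inE.
  by rewrite -[X in _ == X]addr0 (inj_eq (addrI z)) (negPf x0) andbF.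
rewrite addn0 => /(congr1 odd); rewrite odd_double => oddS.
have := pgroup_fix_mod gT2 actsS; rewrite !modn2 oddS => /esym/eqP.
set X := 'Fix_(_ | _)(_)%g; rewrite eqb0 => oddX.
have X0 : 0 \in X.
  rewrite inE (_ : 0 \in S) ?andbT; last by apply/imsetP; exists 0; rewrite ?mulr0.
  by apply/afixP=> g _; rewrite /= /galg_act mul0r.
(* The number of fixed vectors is even and 0 is one of them, so there is another. *)
have [v vX v0] : exists2 v, v \in X & v != 0.
  move: oddX; rewrite (cardsD1 0) X0 /= negbK => oddX0.
  have /card_gt0P[v] : (0 < #|X :\ 0%R|)%N by rewrite lt0n; apply: contraTneq oddX0 => ->.
  by case/setD1P=> v0 vX; exists v.
move: vX => /setIP[/imsetP[y _ vE] /afixP vfix].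
have vconst g : v g = v 1%g.
  by rewrite -{2}(vfix g^-1%g (in_setT _)) /= galg_mul_of invgK mul1g.
have v1 : v 1%g != 0.
  by apply: contraNneq v0 => v1; apply/eqP/ffunP=> g; rewrite vconst v1 ffunE.
exists ((v 1%g)^-1 *: y) => g.
by rewrite -scalerAr -vE galg_scaleE vconst mulVf.
Qed.

Lemma mul_const x y a : (forall g, y g = a) -> forall g, (x * y) g = augmentation x * a.
Proof.
move=> ya g; rewrite ffunE mulr_suml.
by apply: eq_bigr => h _; rewrite ya.
Qed.

(** If [x] killed a nonzero element, it would kill a multiple of it with all coefficients 1, but [x]
    fixes that multiple. So left multiplication by [x] is injective, hence bijective. *)
Lemma augmentation1_unit x : augmentation x = 1 -> x \is a GRing.unit.
Proof.
move=> x1; have x_inj : injective ( *%R x).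
  move=> y z /eqP; rewrite -subr_eq0 -mulrBr => /eqP xyz0; apply/eqP.
  rewrite -subr_eq0; apply/negPn/negP=> /mul_eq_const[t yzt1].
  have := mul_const x yzt1 1%g.
  by rewrite mulrA xyz0 mul0r ffunE x1 mulr1 => /esym/eqP; rewrite oner_eq0.
have [xV _ xxV] := injF_bij x_inj; apply/unitrP; exists (xV 1).
have xxV1 : x * xV 1 = 1 := xxV 1.
by split=> //; apply: x_inj; rewrite mulrA xxV1 mul1r mulr1.
Qed.

Lemma in_unitary_units x :
  (x \in unitary_units F gT)
    = (augmentation x == 1) && (x * canonical_involution x == 1).
Proof.
rewrite !inE; apply: andb_id2l => /eqP/augmentation1_unit xU.
by rewrite -(inj_eq (mulrI xU)) divrr.
Qed.

(** * The quadratic forms [Q_mu] *)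

Definition unitary_form mu x : F := \sum_g \sum_h mu (g * h^-1)%g * (x g * x h).

Definition polarization mu : A := [ffun g => mu g + mu g^-1%g].

Lemma unitary_formE mu x :
  unitary_form mu x = \sum_k mu k * (x * canonical_involution x) k.
Proof.
rewrite /unitary_form; under [RHS]eq_bigr => k _ do rewrite ffunE mulr_sumr.
rewrite [RHS]exchange_big /=; apply: eq_bigr => g _.
rewrite [RHS](reindex_inj (mulgI g)) (reindex_inj (@invg_inj gT)) /=.
by apply: eq_bigr => h _; rewrite canonical_involutionE mulKg invgK.
Qed.

Lemma unitary_formZ mu a x : unitary_form mu (a *: x) = a ^+ 2 * unitary_form mu x.
Proof.
rewrite /unitary_form mulr_sumr; apply: eq_bigr => g _; rewrite mulr_sumr.
by apply: eq_bigr => h _; rewrite !ffunE; ring.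
Qed.

Lemma unitary_formD mu x z :
  unitary_form mu (x + z) = unitary_form mu x + unitary_form mu z
                            + \sum_g x g * (polarization mu * z) g.
Proof.
have -> : \sum_g x g * (polarization mu * z) g =
    \sum_g \sum_h mu (g * h^-1)%g * (x g * z h)
    + \sum_g \sum_h mu (g * h^-1)%g * (z g * x h).
  rewrite [X in _ + X]exchange_big -big_split; apply: eq_bigr => g _ /=.
  rewrite galg_mulE mulr_sumr -big_split; apply: eq_bigr => h _ /=.
  by rewrite !ffunE invMg invgK; ring.
rewrite -!big_split /=; apply: eq_bigr => g _; rewrite -!big_split /=.
apply: eq_bigr => h _; rewrite !galg_addE -!mulrDr; congr (_ * _).
ring.
Qed.

(** Group elements are unitary, so [k] cancels in [(x k) (x k)']. *)
Lemma unitary_form_mul_of mu x k :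
  unitary_form mu (x * galg_of F k) = unitary_form mu x.
Proof.
rewrite [RHS](reindex_inj (mulIg k^-1)%g); apply: eq_bigr => g _ /=.
rewrite [RHS](reindex_inj (mulIg k^-1)%g); apply: eq_bigr => h _ /=.
by rewrite !galg_mul_of invMg invgK mulgA mulgKV.
Qed.

End GroupAlgebra.

(** * Rigidity: lam is a homomorphism to F_2 *)

(** [u] lifts an element of order two in the centre of the quotient by [K], a nontrivial 2-group. *)
Lemma pgroup_central_order2 (gT : finGroupType) (K : {group gT}) :
    (2.-group [set: gT])%g -> (K <| [set: gT])%g -> K != [set: gT] :> {set gT} ->
  exists u, [/\ u \notin K, (u ^+ 2)%g \in K
              & forall g, (u * g * u^-1 * g^-1)%g \in K].
Proof.
move=> gT2 nK KnT; have nKg g : g \in 'N(K)%g by apply: (subsetP (normal_norm nK)).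
have GK2 : (2.-group ([set: gT] / K))%g by apply: quotient_pgroup.
have : ('Z([set: gT] / K) != 1)%g.
  apply: contra KnT => /eqP/(trivg_center_pgroup GK2)/eqP.
  by rewrite -subG1 quotient_sub1 ?normal_norm // eqEsubset subsetT.
have Z2 : (2.-group 'Z([set: gT] / K))%g by apply: pgroupS GK2; apply: center_sub.
case/(pgroup_pdiv Z2) => _ /Cauchy[//|v vZ v_order2] _.
have [u _ _ vE] := morphimP (subsetP (center_sub _) _ vZ).
exists u; rewrite vE in vZ v_order2; split.
- apply/negP=> uK; move: v_order2; rewrite /= coset_id // order1 //.
- by apply: coset_idr => //; rewrite morphX // -v_order2 expg_order.
- move=> g; apply: coset_idr => //.
  rewrite !morphM ?morphV ?groupM ?groupV //=.
  have /centP/(_ (coset K g)) : coset K u \in 'C([set: gT] / K)%g.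
    by case/setIP: vZ.
  by rewrite mem_quotient ?inE // => -> //; rewrite mulgK mulgV.
Qed.

Section Rigidity.

Variables (F : finFieldType) (gT : finGroupType).
Local Notation A := (galg F gT).
Implicit Types (x y z : A) (a : F) (g h k : gT).
Hypotheses (F2 : 2%N \in [pchar F]) (gT2 : (2.-group [set: gT])%g).
Variable mu : A.
(* Otherwise the character sum attached to mu vanishes, see character_sum_eq0. *)
Hypothesis muP : forall z a, augmentation z = 0 ->
  (forall g, (polarization mu * z) g = a) -> unitary_form mu z = a ^+ 2.

Local Notation lam := (polarization mu).

Lemma polarization1 : lam 1%g = 0.
Proof. by rewrite ffunE invg1 addrr_pchar2. Qed.

Lemma polarizationV g : lam g^-1%g = lam g.
Proof. by rewrite !ffunE invgK addrC. Qed.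

(** The last condition puts [lam k] in the prime field: [semiperiods] is the whole group exactly
    when [lam] is a homomorphism to F_2. *)
Definition semiperiods : {set gT} :=
  [set k | [forall g, lam (g * k)%g == lam g + lam k] && (lam k ^+ 2 == lam k)].

Lemma semiperiodsP k :
  reflect ((forall g, lam (g * k)%g = lam g + lam k) /\ lam k ^+ 2 = lam k)
          (k \in semiperiods).
Proof.
rewrite inE; apply: (iffP andP) => -[].
  by move=> /forallP lamk /eqP; split=> // g; apply/eqP.
by move=> lamk ->; split=> //; apply/forallP=> g; apply/eqP.
Qed.

Fact group_set_semiperiods : group_set semiperiods.
Proof.
apply/group_setP; split.
  by apply/semiperiodsP; split=> [g|]; rewrite ?mulg1 polarization1 ?addr0 // expr0n.
move=> h k /semiperiodsP[lamh lamh2] /semiperiodsP[lamk lamk2].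
apply/semiperiodsP; split=> [g|]; first by rewrite mulgA !lamk lamh addrA.
by rewrite lamk sqrrD mulr2n addrr_pchar2 // addr0 lamh2 lamk2.
Qed.

Canonical semiperiods_group := Group group_set_semiperiods.

(** Additivity at [k ^+ 2], applied to [k^-1], reads [lam k = lam k^-1 + lam (k ^+ 2)]. *)
Lemma sqr_semiperiod k : (k ^+ 2)%g \in semiperiods -> lam (k ^+ 2)%g = 0.
Proof.
case/semiperiodsP=> lamk2 _; apply: (addrI (lam k^-1%g)).
by rewrite -lamk2 expgS expg1 mulKg addr0 polarizationV.
Qed.

(* The test vectors are z = y (1 + u). Modulo constants lam z is sigma y, while
   unitary_form mu z does not see sigma; so if sigma were not constant, some y of
   augmentation 0 with sigma y = 1 would contradict muP. *)
Lemma semiperiods_central_ext (K : {group gT}) u :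
    (K <| [set: gT])%g -> K \subset semiperiods -> (u ^+ 2)%g \in K ->
    (forall g, u * g * u^-1 * g^-1 \in K)%g ->
  u \in semiperiods.
Proof.
move=> nK sKP u2K ucK.
have lamK k g : k \in K -> lam (g * k)%g = lam g + lam k.
  by case/(subsetP sKP)/semiperiodsP.
have conjK g k : k \in K -> (g * k * g^-1)%g \in K.
  move=> kK; rewrite -[(g * k * g^-1)%g]/((g * k) * g^-1)%g.
  have := memJ_norm k (subsetP (normal_norm nK) g^-1%g (in_setT _)).
  by rewrite conjgE invgK mulgA kK.
pose c g := (u * g * u^-1 * g^-1)%g.
have lam_sqr g : lam (g * u ^+ 2 * g^-1)%g = 0.
  have gu2 : (g * u ^+ 2 * g^-1 = (g * u * g^-1) ^+ 2)%g.
    by rewrite !expgS !expg0 !mulg1 !mulgA mulgKV.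
  by rewrite gu2 sqr_semiperiod // -gu2 (subsetP sKP) // conjK.
pose sigma : A := [ffun w => lam w + lam (w * u^-1)%g].
(* Since [h u^-1 g^-1 = (h g^-1 u^-1) (c g)] with [c g] in [K], a term [lam (c g)] free of [h]
   splits off. *)
have mul_ext y h : (lam * (y + y * galg_of F u)) h
    = (sigma * y) h + \sum_g lam (c g) * y g.
  rewrite mulrDr mulrA galg_addE galg_mul_of !galg_mulE -!big_split.
  apply: eq_bigr => g _ /=; rewrite -!mulrDl [sigma _]ffunE -addrA.
  rewrite -(lamK (c g) (h * g^-1 * u^-1)%g (ucK g)).
  by rewrite /c !mulgA !mulgKV.
(* By translation invariance only the polar term remains; its coefficients [lam (g u^-1 h^-1)] are
   symmetric, so it reduces to the diagonal. *)
have form_ext y : unitary_form mu (y + y * galg_of F u)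
    = lam u * augmentation y ^+ 2 + (\sum_g lam (c g) * y g) ^+ 2.
  rewrite unitary_formD unitary_form_mul_of addrr_pchar2 // add0r mulrA.
  under eq_bigr => g _ do rewrite galg_mul_of galg_mulE mulr_sumr.
  rewrite sum_sym_pchar2 // => [|g h]; last first.
    rewrite mulrCA [RHS]mulrCA [y h * _]mulrC; congr (_ * _).
    rewrite -[LHS]polarizationV !invMg !invgK mulgA.
    (* The inverse of [g u^-1 h^-1] differs from [h u^-1 g^-1] by a conjugate of [u ^+ 2], where
       [lam] vanishes. *)
    have -> : (h * u * g^-1 = h * u^-1 * g^-1 * (g * u ^+ 2 * g^-1))%g.
      by rewrite !expgS expg0 mulg1 !mulgA !mulgKV.
    by rewrite (lamK _ (h * u^-1 * g^-1)%g (conjK g _ u2K)) lam_sqr addr0.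
  rewrite sum_sqr_pchar2 // sum_sqr_pchar2 // mulr_sumr -big_split.
  apply: eq_bigr => g _ /=.
  have -> : (g * u^-1 * g^-1 = u^-1 * c g)%g by rewrite /c !mulgA mulVg mul1g.
  have [_ lamc2] := semiperiodsP _ (subsetP sKP _ (ucK g)).
  by rewrite (lamK _ u^-1%g (ucK g)) polarizationV exprMn lamc2; ring.
have aug_ext y : augmentation (y + y * galg_of F u) = 0.
  by rewrite augmentationD augmentation_mul_of addrr_pchar2.
(* Both sides of [muP] contain [b ^+ 2], which cancels. *)
have key y a : (forall g, (sigma * y) g = a) -> lam u * augmentation y ^+ 2 = a ^+ 2.
  move=> sya; set b := \sum_g lam (c g) * y g.
  have /muP : forall h, (lam * (y + y * galg_of F u)) h = a + b.
    by move=> h; rewrite mul_ext sya.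
  move=> /(_ (aug_ext y)); rewrite form_ext sqrrD mulr2n addrr_pchar2 // addr0.
  exact: addIr.
have sigma_const w : sigma w = lam u.
  have -> : lam u = sigma 1%g.
    by rewrite [sigma _]ffunE polarization1 add0r mul1g polarizationV.
  (* Otherwise some [sigma (1 + k) y] is constantly 1; as [(1 + k) y] has augmentation 0, [key]
     would give [0 = 1]. *)
  have sigmaU k : sigma * galg_of F k = sigma.
    apply/eqP/negPn/negP; rewrite -subr_eq0 (galg_oppr F2).
    rewrite addrC -{1}[sigma]mulr1 -mulrDr => /(mul_eq_const F2 gT2)[y sy1].
    have := key ((1 + galg_of F k) * y) 1.
    rewrite mulrA => /(_ sy1); rewrite mulrDl mul1r augmentationD.
    rewrite augmentation_of_mul addrr_pchar2 // !expr2 mulr1 !mulr0.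
    by move/esym/eqP; rewrite oner_eq0.
  by rewrite -{2}(sigmaU w^-1%g) galg_mul_of invgK mul1g.
apply/semiperiodsP; split=> [g|].
  have := sigma_const (g * u)%g; rewrite [sigma _]ffunE mulgK => <-.
  by rewrite addrCA addrr_pchar2 // addr0.
(* At [y = 1], [key] puts [lam u] in the prime field. *)
have := key 1 (lam u).
by rewrite mulr1 => /(_ sigma_const) <-; rewrite augmentation1 expr1n mulr1.
Qed.

(** Otherwise the normal core [K] is proper. Adjoining some [u] that is central of order two modulo
    [K] gives a larger normal subgroup inside [semiperiods], against the maximality of the core. *)
Theorem semiperiodsT : semiperiods = [set: gT].
Proof.
apply/eqP/negPn/negP=> PnT; set K := gcore semiperiods [set: gT].
have nK : (K <| [set: gT])%g by rewrite gcore_normal ?subsetT.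
have sKP : K \subset semiperiods by apply: gcore_sub.
have KnT : K != [set: gT].
  by apply: contra PnT => /eqP KT; rewrite eqEsubset subsetT -KT.
have [u [uK u2K ucK]] := pgroup_central_order2 gT2 nK KnT.
have uP := semiperiods_central_ext nK sKP u2K ucK.
case/negP: uK; have: <<u |: K>>%g \subset K.
  apply: gcore_max; first by rewrite gen_subG subUset sub1set uP.
  apply/subsetP=> g _; rewrite inE -genJ gen_subG; apply/subsetP=> _ /imsetP[k kuK ->].
  case/setU1P: kuK => [->|kK].
    have -> : (u ^ g = (u * g^-1 * u^-1 * g^-1^-1)^-1 * u)%g.
      by rewrite conjgE !invMg !invgK !mulgA mulgKV.
    by rewrite groupM ?groupV ?mem_gen ?setU11 // setU1r.
  by rewrite mem_gen // setU1r // memJ_norm // (subsetP (normal_norm nK)).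
by move/subsetP; apply; rewrite mem_gen // setU11.
Qed.

End Rigidity.

(** * Homomorphisms to F_2 trivial on involutions *)

(** F_2 is encoded as [bool] with [addb], so that the set depends on the group alone. *)
Definition involution_free_characters (gT : finGroupType) : {set {ffun gT -> bool}} :=
  [set phi : {ffun gT -> bool} |
    [forall g, forall h, phi (g * h)%g == phi g (+) phi h]
    && [forall g in square_roots (1%g : gT), ~~ phi g]].

Lemma involution_free_charactersP (gT : finGroupType) (phi : {ffun gT -> bool}) :
  reflect ((forall g h, phi (g * h)%g = phi g (+) phi h)
           /\ (forall g, (g ^+ 2)%g = 1%g -> phi g = false))
          (phi \in involution_free_characters gT).
Proof.
rewrite inE; apply: (iffP andP) => -[phiM phi2]; split.
- by move=> g h; apply/eqP; move/forallP/(_ g)/forallP: phiM.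
- by move=> g g2; apply/negbTE/(forall_inP phi2); rewrite inE g2.
- by apply/forallP=> g; apply/forallP=> h; rewrite phiM.
- by apply/forall_inP=> g /[!inE]/eqP/phi2 ->.
Qed.

(** * Evaluation of the character sums *)

Section Counting.

Variables (F : finFieldType) (gT : finGroupType).
Local Notation A := (galg F gT).
Local Notation V := (normalized_units F gT).
Implicit Types (x y z mu : A) (a : F) (g h k : gT) (phi : {ffun gT -> bool}).
Hypotheses (F2 : 2%N \in [pchar F]) (gT2 : (2.-group [set: gT])%g).

(** Translation by [(a - 1) *: 1] maps [V] onto the elements of augmentation [a]. *)
Lemma card_galg_normalized_units : #|A| = (#|F| * #|V|)%N.
Proof.
rewrite -[LHS]sum1_card (partition_big (@augmentation F gT) xpredT) //=.
rewrite -[RHS]sum_nat_const; apply: eq_big => // a _.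
rewrite (reindex_inj (addrI ((a - 1) *: (1 : A)))) -sum1_card; apply: eq_bigl => x.
rewrite inE augmentationD augmentationZ augmentation1 mulr1.
by rewrite /= -subr_eq0 [_ - a](_ : _ = augmentation x - 1) ?subr_eq0 //; ring.
Qed.

Definition character_sum mu : int :=
  \sum_(x in V) as_sign (unitary_form mu x + mu 1%g).

(** Orthogonality: for fixed [x], the sum over [mu] is that of a character of F^G, trivial exactly
    when [x x' = 1]. *)
Lemma sum_character_sum :
  \sum_mu character_sum mu = (#|unitary_units F gT| * #|A|)%N%:R.
Proof.
rewrite /character_sum exchange_big /= (bigID (mem (unitary_units F gT))) /=.
pose d x : A := x * canonical_involution x - 1.
have formE mu x : unitary_form mu x + mu 1%g = \sum_k mu k * d x k.
  rewrite unitary_formE; have -> : mu 1%g = \sum_k mu k * (1 : A) k.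
    rewrite (bigD1 1%g) //= ffunE eqxx mulr1 big1 ?addr0 // => k /negPf k1.
    by rewrite ffunE k1 mulr0.
  rewrite -big_split; apply: eq_bigr => k _.
  by rewrite /d (galg_oppr F2) galg_addE mulrDr.
rewrite [X in _ + X]big1 ?addr0 => [|x /andP[xV xU]]; last first.
  have dx0 : d x != 0.
    apply: contraNneq xU => /eqP; rewrite subr_eq0 => xx1.
    by rewrite in_unitary_units // xx1 andbT; rewrite inE in xV.
  have [k dxk] : exists k, d x k != 0.
    apply/existsP; apply: contraR dx0; rewrite negb_exists => /forallP dxk.
    by apply/eqP/ffunP=> k; rewrite [RHS]ffunE; apply/eqP; rewrite -[_ == _]negbK dxk.
  (* Adding [b] to the coefficient of [mu] at [k] flips every sign. *)
  have [b db] := as_sign_nontrivial F2 dxk.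
  apply: (sum_eq0_odd (addrI (b *: galg_of F k))) => // mu _.
  rewrite !formE; under eq_bigr => h _ do rewrite galg_addE mulrDl.
  rewrite big_split as_signD //= -[RHS]mulN1r; congr (_ * _).
  rewrite (bigD1 k) //= big1 ?addr0 => [|h /negPf hk];
    rewrite galg_scaleE [galg_of _ _ _]ffunE.
    by rewrite eqxx mulr1.
  by rewrite hk mulr0 mul0r.
rewrite natrM mulr_natl -sumr_const.
rewrite (eq_bigl (mem (unitary_units F gT))) => [|x]; last first.
  by apply: andb_idl => /setIdP[].
apply: eq_bigr => x /=; rewrite in_unitary_units // => /andP[_ /eqP xx1].
rewrite -sumr_const; apply: eq_bigr => mu _.
rewrite formE /d xx1 subrr big1 ?as_sign0 // => k _.
by rewrite ffunE mulr0.
Qed.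

(** Translating [x] by [b *: z] multiplies each sign by psi of [b^2 Q_mu z + b a], which is psi of
    [b^2 (Q_mu z + a^2)]. Squaring is bijective, so some [b] makes this -1. *)
Lemma character_sum_eq0 mu z a :
    augmentation z = 0 -> (forall g, (polarization mu * z) g = a) ->
    unitary_form mu z != a ^+ 2 ->
  character_sum mu = 0.
Proof.
move=> z0 muz zna.
have sqr_inj : injective (fun b : F => b ^+ 2).
  move=> b c /eqP; rewrite -subr_eq0 subr_sqr (oppr_pchar2 F2) mulf_eq0 orbb.
  by rewrite addr_eq0 (oppr_pchar2 F2) => /eqP.
have : unitary_form mu z + a ^+ 2 != 0 by rewrite addr_eq0 (oppr_pchar2 F2).
case/(as_sign_nontrivial F2) => c; have [r _ rK] := injF_bij sqr_inj.
rewrite -[c]rK /=; set b := r c => signb.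
apply: (sum_eq0_odd (addIr (b *: z))) => [x|x].
  by rewrite !inE augmentationD augmentationZ z0 mulr0 addr0.
rewrite inE => /eqP x1; rewrite unitary_formD unitary_formZ.
under eq_bigr => g _ do rewrite -scalerAr galg_scaleE muz.
rewrite -mulr_suml -/(augmentation x) x1 mul1r.
rewrite (_ : _ + mu 1%g = unitary_form mu x + mu 1%g
    + (b ^+ 2 * unitary_form mu z + b * a)); last by ring.
rewrite as_signD // -[RHS]mulrN1 -signb mulrDr !as_signD // -exprMn as_signX2 //.
Qed.

(** Split the augmentation as [a + a' = 1] along [phi]. The form [Q_mu x + a a'] has symmetric
    coefficients and diagonal sum [mu 1], so psi is applied to [a a' = a^2 + a]. *)
Lemma polarization_character mu phi :
    phi \in involution_free_characters gT ->
    (forall g, polarization mu g = (phi g)%:R) ->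
  character_sum mu = #|V|%:R.
Proof.
case/involution_free_charactersP=> phiM _ muphi; rewrite /character_sum -sumr_const.
have phi1 : phi 1%g = false by have := phiM 1%g 1%g; rewrite mulg1 addbb.
have phiV g : phi g^-1%g = phi g.
  by have := phiM g g^-1%g; rewrite mulgV phi1; case: (phi g); case: (phi g^-1%g).
apply: eq_bigr => x; rewrite inE => /eqP x1.
pose a := \sum_(g | phi g) x g; pose a' := \sum_(g | ~~ phi g) x g.
have aa' : a + a' = 1 by rewrite -x1 [RHS](bigID phi).
have aa'E : a * a' = \sum_g \sum_h (phi g && ~~ phi h)%:R * (x g * x h).
  rewrite mulr_suml [LHS]big_mkcond; apply: eq_bigr => g _.
  case: (phi g) => /=; last by rewrite big1 // => h _; rewrite mul0r.
  rewrite mulr_sumr [LHS]big_mkcond; apply: eq_bigr => h _.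
  by case: (phi h); rewrite ?mul0r ?mul1r.
have : unitary_form mu x + a * a' = mu 1%g.
  rewrite aa'E -big_split; under eq_bigr => g _ do rewrite -big_split.
  rewrite sum_sym_pchar2 //= => [|g h]; last first.
    have := muphi (g * h^-1)%g; rewrite [polarization _ _]ffunE phiM phiV invMg invgK.
    move/(canRL (addrK _)) => ->; rewrite (oppr_pchar2 F2).
    rewrite [x h * x g]mulrC; case: (phi g); case: (phi h) => /=; try by ring.
    by rewrite mulrDl mul1r addrAC addrr_pchar2 // add0r mul0r addr0.
  rewrite -[RHS]mulr1 -[X in _ = _ * X](expr1n _ 2) -x1 sum_sqr_pchar2 // mulr_sumr.
  by apply: eq_bigr => g _; rewrite mulgV andbN mul0r addr0.
move/(canRL (addrK _)) => ->; rewrite (oppr_pchar2 F2) addrAC addrr_pchar2 // add0r.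
have -> : a * a' = artin_schreier a.
  rewrite (_ : a' = a + 1) /artin_schreier; first by ring.
  by rewrite -aa' addKr_pchar2.
exact: as_sign_artin_schreier.
Qed.

Lemma exists_polarization_character mu :
    (forall z a, augmentation z = 0 ->
      (forall g, (polarization mu * z) g = a) -> unitary_form mu z = a ^+ 2) ->
  exists2 phi, phi \in involution_free_characters gT
             & forall g, polarization mu g = (phi g)%:R.
Proof.
move=> /(semiperiodsT F2 gT2) muT.
have muP k : (forall g, polarization mu (g * k)%g = polarization mu g + polarization mu k)
    /\ polarization mu k ^+ 2 = polarization mu k.
  by apply/semiperiodsP; rewrite muT inE.
have lamE g : polarization mu g = (polarization mu g != 0)%:R.
  have [_ lam2] := muP g; case: eqVneq => [//|lam0].
  by apply: (mulfI lam0); rewrite mulr1 -expr2.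
have lamM g h : polarization mu (g * h)%g = polarization mu g + polarization mu h.
  by have [-> _] := muP h.
exists [ffun g => polarization mu g != 0] => [|g]; last by rewrite [in RHS]ffunE -lamE.
apply/involution_free_charactersP; split=> [g h|g g2]; last first.
  (* When [g^-1 = g], the two terms of the polarization cancel. *)
  rewrite ffunE [polarization mu g]ffunE (_ : g^-1 = g)%g ?addrr_pchar2 ?eqxx //.
  by apply/eqP; rewrite eq_invg_mul -[(g * g)%g]/(g ^+ 2)%g g2.
rewrite [LHS]ffunE [X in X (+) _]ffunE [X in _ (+) X]ffunE lamM (lamE g) (lamE h).
case: (polarization mu g != 0); case: (polarization mu h != 0);
  by rewrite ?addr0 ?add0r ?addrr_pchar2 ?oner_eq0 ?eqxx.
Qed.

(** At most one [phi] matches [mu]; the sum form lets the summations over [mu] and [phi] be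
    exchanged. *)
Lemma character_sumE mu :
  character_sum mu
    = \sum_(phi in involution_free_characters gT
            | [forall g, polarization mu g == (phi g)%:R]) #|V|%:R.
Proof.
case: (pickP [pred phi in involution_free_characters gT
               | [forall g, polarization mu g == (phi g)%:R]]) => [phi|nophi].
  case/andP=> phiX /forallP muphi.
  rewrite (big_pred1 phi) => [|psi /=].
    by apply: polarization_character phiX _ => g; apply/eqP.
  apply/andP/eqP=> [[_ /forallP mupsi]|->]; last by split=> //; apply/forallP.
  apply/ffunP=> g; have := mupsi g; rewrite (eqP (muphi g)).
  by case: (phi g); case: (psi g); rewrite // ?oner_eq0 // eq_sym oner_eq0.
rewrite (eq_bigl _ _ nophi) big_pred0_eq.
case: (pickP [pred za : A * F | [&& augmentation za.1 == 0,
    [forall g, (polarization mu * za.1) g == za.2]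
  & unitary_form mu za.1 != za.2 ^+ 2]]) => [[z a] /and3P[/= /eqP z0 /forallP muz]|noz].
  by apply: character_sum_eq0 z0 _ => g; apply/eqP.
have [|phi phiX muphi] := @exists_polarization_character mu.
  move=> z a z0 muz; have := noz (z, a); rewrite /= z0 eqxx /=.
  rewrite (introT forallP) => [/negbFE/eqP //|g]; exact/eqP.
by have := nophi phi; rewrite /= phiX (introT forallP) // => g; apply/eqP.
Qed.

(** * Fibres of the polarization and the final count *)

(** [R] picks one of each pair [g], [g^-1]. The values of [mu] on [R] are free and determine the
    others; where [g = g^-1], the equation is [0 = phi g], true as [phi] is trivial on
    involutions. *)
Lemma card_polarization_fibre phi : phi \in involution_free_characters gT ->
  #|[set mu : A | [forall g, polarization mu g == (phi g)%:R]]|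
    = (#|F| ^ ((#|gT| + #|square_roots (1%g : gT)|)./2))%N.
Proof.
case/involution_free_charactersP=> phiM phi2.
have phi1 : phi 1%g = false by have := phiM 1%g 1%g; rewrite mulg1 addbb.
have phiV g : phi g^-1%g = phi g.
  by have := phiM g g^-1%g; rewrite mulgV phi1; case: (phi g); case: (phi g^-1%g).
pose R := [set g in [set: gT] | (enum_rank g <= enum_rank g^-1%g)%N].
have cardR : (#|gT| + #|square_roots (1%g : gT)|)%N = #|R|.*2.
  rewrite -card_involution ?cardsT; [|exact: invgK|by move=> ? _; rewrite inE].
  congr (_ + _)%N; apply: eq_card => g.
  by rewrite !inE eq_invg_mul expgS expg1.
have RV g : g \notin R -> g^-1%g \in R.
  by rewrite !inE invgK -ltnNge => /ltnW.
have RRV g : g \in R -> g^-1%g \in R -> g^-1%g = g.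
  rewrite !inE invgK /= => le1 le2.
  by apply/esym/enum_rank_inj/val_inj/eqP; rewrite eqn_leq le1.
rewrite cardR doubleK.
(* The default 0 off [R] matches [pffun_on], which counts functions supported in [R]. *)
pose r (mu : A) : {ffun gT -> F} := [ffun g => if g \in R then mu g else 0].
have r_inj :
    {in [set mu : A | [forall g, polarization mu g == (phi g)%:R]] &, injective r}.
  move=> mu mu' /[!inE]/forallP muphi /forallP mu'phi /ffunP eq_r.
  have eqR g : g \in R -> mu g = mu' g by move=> gR; have := eq_r g; rewrite !ffunE gR.
  apply/ffunP=> g; have [/eqR//|/RV/eqR eqV] := boolP (g \in R).
  apply: (addIr (mu g^-1%g)); rewrite {2}eqV.
  by have := eqP (muphi g); rewrite ffunE -(eqP (mu'phi g)) ffunE.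
rewrite -(card_in_imset r_inj) -(card_pffun_on 0 (mem R) (mem F)); apply: eq_card => nu.
apply/imsetP/pffun_onP=> [[mu _ ->]|[/subsetP suppR _]].
  split=> //; apply/subsetP=> g; rewrite inE ffunE.
  by case: ifP => //; rewrite eqxx.
exists [ffun g => if g \in R then nu g else (phi g)%:R + nu g^-1%g].
  rewrite inE; apply/forallP=> g; apply/eqP; rewrite !ffunE invgK.
  case: (boolP (g \in R)) => gR; case: (boolP (g^-1%g \in R)) => gVR.
  - have gV := RRV g gR gVR.
    by rewrite gV addrr_pchar2 // phi2 // expgS expg1 -{1}gV mulVg.
  - by rewrite phiV addrCA addrr_pchar2 // addr0.
  - by rewrite -addrA addrr_pchar2 // addr0.
  - by rewrite RV in gVR.
apply/ffunP=> g; rewrite ffunE; case: ifPn => [gR|]; first by rewrite ffunE gR.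
by move=> gR; apply/eqP; apply: contraNT gR => nug; apply: suppR.
Qed.

Lemma card_unitary_units :
  #|unitary_units F gT|
    = (#|involution_free_characters gT| * #|F| ^ unitary_exponent gT)%N.
Proof.
set X := involution_free_characters gT.
pose e := (#|gT| + #|square_roots (1%g : gT)|)./2.
have F0 : (0 < #|F|)%N by apply/card_gt0P; exists 0.
(* Positivity of [e] lets the factor [#|F|] of [#|A| = #|F| * #|V|] cancel against [#|F| ^ e],
   leaving the exponent [e - 1]. *)
have e0 : (0 < e)%N.
  rewrite half_gt0; apply: (@leq_add 1 1).
    by apply/card_gt0P; exists 1%g.
  by apply/card_gt0P; exists 1%g; rewrite inE expg1n.
have : (#|unitary_units F gT| * #|A|)%N%:R
     = (#|X| * #|F| ^ e * #|V|)%N%:R :> int.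
  rewrite -sum_character_sum; under eq_bigr do rewrite character_sumE.
  rewrite (exchange_big_dep (mem X)) /= => [|mu phi _ /andP[]//].
  rewrite (eq_bigr (fun=> (#|F| ^ e * #|V|)%N%:R)) => [|phi phiX].
    by rewrite sumr_const -mulrnA [in LHS]mulnC mulnA.
  rewrite phiX -(card_polarization_fibre phiX) sumr_const -mulrnA mulnC.
  congr (_ *+ (_ * _)).
  by apply: eq_card => mu; rewrite inE.
move/eqP; rewrite Num.Theory.eqr_nat card_galg_normalized_units mulnA eqn_pmul2r.
  2: by apply/card_gt0P; exists 1; rewrite inE augmentation1.
rewrite -(prednK e0) expnSr mulnA eqn_pmul2r // => /eqP ->.
by rewrite /unitary_exponent subn1.
Qed.

End Counting.

Theorem theorem2 (gT : finGroupType) (hG : (2.-group [set: gT])%g) :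
  (forall F : finFieldType, 2%N \in [pchar F]%R ->
     exists Theta : int,
       (#|unitary_units F gT|%:Z = Theta * (#|F| ^ unitary_exponent gT)%N%:Z)%R)
  /\
  ((exists c : gT, [/\ #[c]%g = 2%N, c \in 'Z([set: gT])%g
      & {in square_roots c &, forall g h : gT, commute g h}]) ->
   exists Theta : int,
     forall F : finFieldType, 2%N \in [pchar F]%R ->
       (#|unitary_units F gT|%:Z = Theta * (#|F| ^ unitary_exponent gT)%N%:Z)%R).
Proof.
have cardU (F : finFieldType) : 2%N \in [pchar F]%R ->
    (#|unitary_units F gT|%:Z =
      #|involution_free_characters gT|%:Z * (#|F| ^ unitary_exponent gT)%N%:Z)%R.
  by move=> F2; rewrite -PoszM card_unitary_units.
(* The witness is built without [F], so it serves all fields at once. *)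
split=> [F F2 | _]; exists #|involution_free_characters gT|%:Z; last exact: cardU.
exact: cardU.
Qed.
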